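(* The structure of a probabilistic approach space on a set $X$ may be described equivalently as a map $\ell:\mathsf UX\to\mathbf\Delta^X$ satisfying, for all $x,z\in X$, $\mathfrak X\in\mathsf U\mathsf UX$, $\mathfrak y\in\mathsf UX$: (R'') $\kappa\le\ell(\dot x)(x)$; (T'') $\Big(\bigwedge_{\mathcal A\in\mathfrak X,\,B\in\mathfrak y}\ \bigvee_{\mathfrak x\in\mathcal A,\,y\in B}(\ell\mathfrak x)(y)\Big)\odot(\ell\mathfrak y)(z)\le\ell(\Sigma_X\mathfrak X)(z)$. Here a probabilistic approach structure $\delta$ and the map $\ell$ correspond to each other via $\delta(x,A)=\bigvee_{\mathfrak x\in\mathsf UX,\,A\in\mathfrak x}(\ell\mathfrak x)(x)$ and $(\ell\mathfrak x)(x)=\bigwedge_{A\in\mathfrak x}\delta(x,A)$. A map $f:X\to Y$ of probabilistic approach spaces, presented as $(X,\ell)$ and $(Y,\ell')$, is contractive precisely when (M'') $(\ell\mathfrak x)(x)\le(\ell' f[\mathfrak x])(f(x))$ for all $\mathfrak x\in\mathsf UX$, $x\in X$.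
   Context: $\mathbf\Delta$ is the quantale of distance distribution functions: all $\varphi:[0,\infty]\to[0,1]$ with $\varphi(\beta)=\sup_{\alpha<\beta}\varphi(\alpha)$ for all $\beta\in[0,\infty]$, ordered pointwise, with $(\varphi\odot\psi)(\gamma)=\sup_{\alpha+\beta\le\gamma}\varphi(\alpha)\psi(\beta)$ and neutral element $\kappa$ given by $\kappa(0)=0$, $\kappa(\alpha)=1$ for $\alpha>0$ (also the top element); the bottom element is the constant function $0$. Its underlying lattice is completely distributive. A probabilistic approach space is a set $X$ with a function (probabilistic approach structure) $\delta:X\times\mathsf PX\to\mathbf\Delta$ ($\mathsf PX$ the power set) such that for all $x\in X$, $A,B\subseteq X$, $\varphi\in\mathbf\Delta$: $\delta(x,\{x\})=\kappa$; $\delta(x,\emptyset)=0$; $\delta(x,A\cup B)=\delta(x,A)\vee\delta(x,B)$; $\delta(x,A)\ge\delta(x,A^{(\varphi)})\odot\varphi$, where $A^{(\varphi)}=\{y\in X\mid\delta(y,A)\ge\varphi\}$. A map $f:(X,\delta)\to(Y,\epsilon)$ is contractive if $\delta(x,A)\le\epsilon(f(x),f(A))$ for all $x\in X$, $A\subseteq X$. $\mathsf UX$ is the set of ultrafilters on $X$; $\dot x$ is the principal ultrafilter at $x$; $f[\mathfrak x]=\{B\subseteq Y: f^{-1}B\in\mathfrak x\}$; for $\mathfrak X\in\mathsf U\mathsf UX$, $A\in\Sigma_X\mathfrak X\iff\{\mathfrak x\in\mathsf UX: A\in\mathfrak x\}\in\mathfrak X$. *)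

(* Defs.v *)
From HB Require Import structures.
From mathcomp Require Import all_boot all_order all_algebra.
From mathcomp Require Import all_classical all_reals.
From mathcomp Require Import interval_inference filter.

Set Implicit Arguments.
Unset Strict Implicit.
Unset Printing Implicit Defensive.

Import Order.TTheory GRing.Theory Num.Theory.

Local Open Scope classical_set_scope.
Local Open Scope ring_scope.

(* Suprema of subsets of [0, 1] are computed in R; since [sup set0 = 0] there,
   the empty supremum is the bottom element of [0, 1], as it should be. *)
Section unit_sup.
Variable R : realType.
Implicit Types (S : set R) (x b : R).

Lemma usup_ub S x : (forall y, S y -> y <= 1) -> S x -> x <= sup S.
Proof. by move=> S1 Sx; apply: ub_le_sup => //; exists 1. Qed.

Lemma usup_le S b : 0 <= b -> (forall y, S y -> y <= b) -> sup S <= b.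
Proof.
move=> b0 Sb; have [->|/set0P S0] := eqVneq S set0; first by rewrite sup0.
exact: ge_sup.
Qed.

Lemma usup_ge0 S : (forall y, S y -> 0 <= y <= 1) -> 0 <= sup S.
Proof.
move=> S01; have [->|/set0P[y Sy]] := eqVneq S set0; first by rewrite sup0.
have /andP[y0 _] := S01 _ Sy; apply: (le_trans y0); apply: usup_ub => //.
by move=> z /S01 /andP[].
Qed.

Lemma nonneg_ereal_ge0 (a : {nonneg \bar R}) : (0 <= a%:num)%E.
Proof. by []. Qed.

Lemma nonneg_ereal_ex (x : \bar R) : (0 <= x)%E ->
  exists a : {nonneg \bar R}, a%:num = x.
Proof.
move=> x0; case: (nonnegeP x0) => [|p]; first by exists (+oo%:nng)%E.
by exists (p%:num%:E)%:nng%E.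
Qed.

End unit_sup.

(* Distance distribution functions on [0, +oo]; the order on them is the
   pointwise one. *)
Record ddf (R : realType) := Ddf {
  ddf_fun :> {nonneg \bar R} -> R;
  ddf_itv : forall a, 0 <= ddf_fun a <= 1;
  ddf_sup_lt : forall b,
    ddf_fun b = sup [set ddf_fun a | a in [set a | (a%:num < b%:num)%E]]
}.

Section ddf_quantale.
Variable R : realType.
Implicit Types (phi psi : ddf R) (S : set (ddf R)).

Lemma ddf_ge0 phi a : 0 <= phi a.
Proof. by have /andP[] := ddf_itv phi a. Qed.

Lemma ddf_le1 phi a : phi a <= 1.
Proof. by have /andP[] := ddf_itv phi a. Qed.

Lemma ddf_lt_le phi (a b : {nonneg \bar R}) :
  (a%:num < b%:num)%E -> phi a <= phi b.
Proof.
move=> ab; rewrite [phi b]ddf_sup_lt; apply: usup_ub; last by exists a.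
by move=> _ [c _ <-]; exact: ddf_le1.
Qed.

Lemma ddf_ext phi psi : (forall a, phi a = psi a) -> phi = psi.
Proof.
case: phi psi => [f f1 f2] [g g1 g2] /= /funext fg.
by move: f1 f2; rewrite fg => f1 f2; congr Ddf; exact: Prop_irrelevance.
Qed.

HB.instance Definition _ := gen_eqMixin (ddf R).
HB.instance Definition _ := gen_choiceMixin (ddf R).

Definition ddf_le phi psi : bool := `[< forall a, phi a <= psi a >].

Lemma ddf_le_refl : reflexive ddf_le.
Proof. by move=> phi; apply/asboolP. Qed.

Lemma ddf_le_anti : antisymmetric ddf_le.
Proof.
move=> phi psi /andP[/asboolP h1 /asboolP h2].
by apply: ddf_ext => a; apply/eqP; rewrite eq_le h1 h2.
Qed.

Lemma ddf_le_trans : transitive ddf_le.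
Proof.
move=> phi psi chi /asboolP h1 /asboolP h2.
by apply/asboolP => a; exact: le_trans (h1 a) (h2 a).
Qed.

HB.instance Definition _ := Order.Le_isPOrder.Build ring_display (ddf R)
  ddf_le_refl ddf_le_anti ddf_le_trans.

Lemma ddf_leP phi psi : reflect (forall a, phi a <= psi a) (phi <= psi).
Proof. exact: asboolP. Qed.

Let sup_fun S (a : {nonneg \bar R}) : R := sup [set phi a | phi in S].

Fact ddf_sup_itv S a : 0 <= sup_fun S a <= 1.
Proof.
apply/andP; split.
  by apply: usup_ge0 => _ [phi _ <-]; exact: ddf_itv.
by apply: usup_le => // _ [phi _ <-]; exact: ddf_le1.
Qed.

Fact ddf_sup_sup_lt S b :
  sup_fun S b = sup [set sup_fun S a | a in [set a | (a%:num < b%:num)%E]].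
Proof.
have itv := ddf_sup_itv S; apply/eqP; rewrite eq_le; apply/andP; split.
  apply: usup_le => [|_ [phi Sphi <-]].
    by apply: usup_ge0 => _ [a _ <-]; exact: itv.
  rewrite ddf_sup_lt; apply: usup_le => [|_ [a ab <-]].
    by apply: usup_ge0 => _ [a _ <-]; exact: itv.
  apply: (@le_trans _ _ (sup_fun S a)).
    apply: usup_ub; last by exists phi.
    by move=> _ [psi _ <-]; exact: ddf_le1.
  apply: usup_ub; last by exists a.
  by move=> _ [c _ <-]; have /andP[] := itv c.
apply: usup_le => [|_ [a ab <-]]; first by have /andP[] := itv b.
apply: usup_le => [|_ [phi Sphi <-]]; first by have /andP[] := itv b.
apply: (le_trans (ddf_lt_le phi ab)); apply: usup_ub; last by exists phi.
by move=> _ [psi _ <-]; exact: ddf_le1.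
Qed.

Definition ddf_sup S : ddf R := Ddf (ddf_sup_itv S) (ddf_sup_sup_lt S).

(* Pointwise infima need not be left-continuous, so the meet is not computed
   pointwise but as the join of all lower bounds. *)
Definition ddf_inf S : ddf R := ddf_sup (lbound S).

Lemma ddf_sup_isLub S : isLub S (ddf_sup S).
Proof.
split=> [phi Sphi|psi ub]; apply/ddf_leP => a.
  apply: usup_ub; last by exists phi.
  by move=> _ [psi _ <-]; exact: ddf_le1.
apply: usup_le; first exact: ddf_ge0.
by move=> _ [phi Sphi <-]; have /ddf_leP := ub _ Sphi; apply.
Qed.

Lemma ddf_inf_infimums S : infimums S (ddf_inf S).
Proof.
have [ub lub] := ddf_sup_isLub (lbound S); split => // phi Sphi.
by apply: lub => psi; apply.
Qed.

Fact ddf_zero_itv (a : {nonneg \bar R}) : 0 <= (0 : R) <= 1.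
Proof. by rewrite lexx ler01. Qed.

Fact ddf_zero_sup_lt (b : {nonneg \bar R}) :
  0 = sup [set (0 : R) | a in [set a : {nonneg \bar R} | (a%:num < b%:num)%E]].
Proof.
apply/eqP; rewrite eq_le; apply/andP; split.
  by apply: usup_ge0 => _ [a _ <-]; rewrite lexx ler01.
by apply: usup_le => // _ [a _ <-].
Qed.

Definition ddf_zero : ddf R := Ddf ddf_zero_itv ddf_zero_sup_lt.

Let kappa_fun (a : {nonneg \bar R}) : R := if a%:num == 0%E then 0 else 1.

Fact kappa_itv a : 0 <= kappa_fun a <= 1.
Proof. by rewrite /kappa_fun; case: ifP; rewrite ?lexx ?ler01. Qed.

Fact kappa_sup_lt b :
  kappa_fun b = sup [set kappa_fun a | a in [set a | (a%:num < b%:num)%E]].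
Proof.
apply/eqP; rewrite eq_le; apply/andP; split; last first.
  apply: usup_le => [|_ [a ab <-]]; first by have /andP[] := kappa_itv b.
  rewrite {2}/kappa_fun; case: eqP => [b0|_]; last by have /andP[] := kappa_itv a.
  by move: ab; rewrite /= b0 ltNge nonneg_ereal_ge0.
rewrite {1}/kappa_fun; case: eqVneq => [_|b0].
  by apply: usup_ge0 => _ [a _ <-]; exact: kappa_itv.
have [a [a0 ab]] : exists a : {nonneg \bar R},
    a%:num != 0%E /\ (a%:num < b%:num)%E.
  have : (0 < b%:num)%E by rewrite lt0e b0 /=.
  case: (b%:num)%E => [r| |//] r0; last by exists (1%:E)%:nng%E; rewrite /= onee_eq0 ltry.
  have r2 : 0 <= r / 2 by rewrite divr_ge0 // -lee_fin ltW.
  exists ((NngNum r2)%:num%:E)%:nng%E => /=.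
  by rewrite lte_fin in r0; rewrite eqe mulf_eq0 invr_eq0 pnatr_eq0 orbF
    gt_eqF // lte_fin ltr_pdivrMr // ltr_pMr // ltr1n.
apply: usup_ub; last by exists a => //; rewrite /kappa_fun (negbTE a0).
by move=> _ [c _ <-]; have /andP[] := kappa_itv c.
Qed.

Definition kappa : ddf R := Ddf kappa_itv kappa_sup_lt.

Let mul_fun phi psi (c : {nonneg \bar R}) : R :=
  sup [set phi p.1 * psi p.2 | p in
    [set p : {nonneg \bar R} * {nonneg \bar R} |
      (p.1%:num + p.2%:num <= c%:num)%E]].

Let mulab_itv phi psi a b : 0 <= phi a * psi b <= 1.
Proof. by rewrite mulr_ge0 ?mulr_ile1 ?ddf_ge0 ?ddf_le1. Qed.

Fact ddf_mul_itv phi psi c : 0 <= mul_fun phi psi c <= 1.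
Proof.
apply/andP; split.
  by apply: usup_ge0 => _ [p _ <-]; exact: mulab_itv.
by apply: usup_le => // _ [p _ <-]; have /andP[] := mulab_itv phi psi p.1 p.2.
Qed.

Fact ddf_mul_sup_lt phi psi c :
  mul_fun phi psi c =
  sup [set mul_fun phi psi a | a in [set a | (a%:num < c%:num)%E]].
Proof.
have itv := ddf_mul_itv phi psi.
have ubm d : forall y, [set phi p.1 * psi p.2 | p in
    [set p : {nonneg \bar R} * {nonneg \bar R} |
      (p.1%:num + p.2%:num <= d)%E]] y -> y <= 1.
  by move=> _ [p _ <-]; have /andP[] := mulab_itv phi psi p.1 p.2.
apply/eqP; rewrite eq_le; apply/andP; split; last first.
  apply: usup_le => [|_ [a ac <-]]; first by have /andP[] := itv c.
  apply: usup_le => [|_ [p pa <-]]; first by have /andP[] := itv c.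
  by apply: usup_ub; [exact: ubm|exists p => //; exact: le_trans pa (ltW ac)].
set s := leRHS.
have s0 : 0 <= s by apply: usup_ge0 => _ [a _ <-]; exact: itv.
apply: usup_le => // _ [[a b] /= abc <-].
have main (a' b' : {nonneg \bar R}) :
    (a'%:num < a%:num)%E -> (b'%:num < b%:num)%E -> phi a' * psi b' <= s.
  move=> a'a b'b; have [d dE] := nonneg_ereal_ex (adde_ge0 (nonneg_ereal_ge0 a') (nonneg_ereal_ge0 b')).
  apply: (@le_trans _ _ (mul_fun phi psi d)).
    by apply: usup_ub; [exact: ubm|exists (a', b') => //=; rewrite dE].
  rewrite /s; apply: usup_ub; first by move=> _ [e _ <-]; have /andP[] := itv e.
  by exists d => //=; rewrite dE; exact: lt_le_trans (lteD a'a b'b) abc.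
have half (a' : {nonneg \bar R}) : (a'%:num < a%:num)%E -> phi a' * psi b <= s.
  move=> a'a; have := ddf_ge0 phi a'; rewrite le_eqVlt => /predU1P[<-|p0].
    by rewrite mul0r.
  rewrite mulrC -ler_pdivlMr // ddf_sup_lt.
  apply: usup_le => [|_ [b' b'b <-]]; first by rewrite divr_ge0 // ltW.
  by rewrite ler_pdivlMr // mulrC main.
have := ddf_ge0 psi b; rewrite le_eqVlt => /predU1P[<-|p0].
  by rewrite mulr0.
rewrite -ler_pdivlMr // ddf_sup_lt.
apply: usup_le => [|_ [a' a'a <-]]; first by rewrite divr_ge0 // ltW.
by rewrite ler_pdivlMr // half.
Qed.

Definition ddf_mul phi psi : ddf R :=
  Ddf (ddf_mul_itv phi psi) (ddf_mul_sup_lt phi psi).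

End ddf_quantale.

Arguments ddf_zero {R}.
Arguments kappa {R}.

Declare Scope ddf_scope.
Delimit Scope ddf_scope with D.
Notation "phi ⊙ psi" := (ddf_mul phi psi)
  (at level 40, left associativity) : ddf_scope.
Local Open Scope ddf_scope.

Record ultrafilter (X : Type) := Ultrafilter {
  uf_sets :> set_system X;
  uf_ultra : UltraFilter uf_sets
}.

Lemma ultrafilter_ext X (x y : ultrafilter X) :
  (x : set_system X) = y -> x = y.
Proof.
case: x y => [F FU] [G GU] /= FG; move: FU; rewrite FG => FU.
by congr Ultrafilter; exact: Prop_irrelevance.
Qed.

Lemma setVsetC_ultra X (F : set_system X) : ProperFilter F ->
  (forall A, F A \/ F (~` A)) -> UltraFilter F.
Proof.
move=> PF FC; split=> // G PG FG; apply/seteqP; split=> // A GA.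
have [//|/FG GnA] := FC A.
have : G set0 by rewrite -(setICr A); exact: filterI.
by move/(@filter_not_empty _ G PG).
Qed.

Definition principal_uf X (x : X) : ultrafilter X :=
  Ultrafilter (principal_filter_ultra x).

Fact image_uf_ultra X Y (f : X -> Y) (x : ultrafilter X) :
  UltraFilter [set B | (x : set_system X) (f @^-1` B)].
Proof.
have xU := uf_ultra x; apply: setVsetC_ultra => B.
exact: (in_ultra_setVsetC (f @^-1` B) xU).
Qed.

Definition image_uf X Y (f : X -> Y) (x : ultrafilter X) : ultrafilter Y :=
  Ultrafilter (image_uf_ultra f x).

Fact sum_uf_ultra X (XX : ultrafilter (ultrafilter X)) :
  UltraFilter [set A : set X |
    (XX : set_system _) [set x : ultrafilter X | (x : set_system X) A]].
Proof.
have XU := uf_ultra XX; apply: setVsetC_ultra.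
  split=> [/= XX0|].
    have := @filter_not_empty _ XX _; apply.
    apply: filterS XX0 => x /= x0.
    by have xU := uf_ultra x; exact: (@filter_not_empty _ x _).
  split=> /= [|A B hA hB|A B AB hA].
  - apply: (@filterS _ XX _ setT) => [x _ /=|]; last exact: filterT.
    by have xU := uf_ultra x; exact: filterT.
  - apply: (@filterS _ XX _ _ _ _ (@filterI _ XX _ _ _ hA hB)) => x [/= xA xB].
    by have xU := uf_ultra x; exact: filterI.
  - apply: (@filterS _ XX _ _ _ _ hA) => x /= xA.
    by have xU := uf_ultra x; exact: filterS xA.
move=> A /=.
have [?|h] := in_ultra_setVsetC [set x : ultrafilter X | (x : set_system X) A] XU.
  by left.
right; apply: filterS h => x /= nxA.
by have [] := in_ultra_setVsetC A (uf_ultra x).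
Qed.

Definition sum_uf X (XX : ultrafilter (ultrafilter X)) : ultrafilter X :=
  Ultrafilter (sum_uf_ultra XX).

(* [is_prob_limit] axiomatizes ultrafilter convergence as maps
   UX -> (X -> ddf R); [limit_of] and [approach_of] are the two passages
   between such maps and probabilistic approach structures. *)
Section probabilistic_approach.
Variable R : realType.

Record is_prob_approach X (delta : X -> set X -> ddf R) : Prop := {
  pa_point : forall x, delta x [set x] = kappa;
  pa_set0 : forall x, delta x set0 = ddf_zero;
  pa_setU : forall x A B,
    delta x (A `|` B) = ddf_sup [set delta x A; delta x B];
  pa_enlarge : forall x A (phi : ddf R),
    delta x [set y | phi <= delta y A] ⊙ phi <= delta x A
}.

Definition contractive X Y (delta : X -> set X -> ddf R)
    (epsilon : Y -> set Y -> ddf R) (f : X -> Y) : Prop :=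
  forall x A, delta x A <= epsilon (f x) (f @` A).

Record is_prob_limit X (l : ultrafilter X -> X -> ddf R) : Prop := {
  pl_refl : forall x, kappa <= l (principal_uf x) x;
  pl_trans : forall (XX : ultrafilter (ultrafilter X)) (yy : ultrafilter X) z,
    ddf_inf [set ddf_sup [set l xx y | xx in AA & y in B]
              | AA in (XX : set_system (ultrafilter X)) &
                B in (yy : set_system X)]
      ⊙ l yy z <= l (sum_uf XX) z
}.

Definition limit_of X (delta : X -> set X -> ddf R) :
    ultrafilter X -> X -> ddf R :=
  fun xx x => ddf_inf [set delta x A | A in (xx : set_system X)].

Definition approach_of X (l : ultrafilter X -> X -> ddf R) :
    X -> set X -> ddf R :=
  fun x A => ddf_sup [set l xx x
    | xx in [set xx : ultrafilter X | (xx : set_system X) A]].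

End probabilistic_approach.

(* Main.v *)
Require Import Defs.
From mathcomp Require Import all_boot all_order all_algebra.
From mathcomp Require Import all_classical all_reals.
From mathcomp Require Import interval_inference filter.

(** Complete distributivity of the lattice of distance distribution functions
    is used through step functions: [r < (sup S) a] iff [r < phi a] for some
    [phi] in [S], while a uniform bound [r <= phi a] on [S] bounds [inf S] from
    below by the step function jumping to [r] right after [a].  Left-continuity
    lets every bound [r < phi a] be pushed to some [b < a].  With this, each
    half of the correspondence reduces to building an ultrafilter: one
    containing [A] and avoiding the ideal of the sets [B] with
    [delta x B a <= r]; the image of [yy] under a choice of ultrafilters
    witnessing [phi <= delta y A]; and an ultrafilter of ultrafilters with sum
    [xx] that contains a given [P], when each set in [xx] belongs to some
    member of [P]. *)

Set Implicit Arguments.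
Unset Strict Implicit.
Unset Printing Implicit Defensive.

Import Order.TTheory GRing.Theory Num.Theory.

Local Open Scope classical_set_scope.
Local Open Scope ring_scope.
Local Open Scope ddf_scope.

(** * Order, step functions and product of distance distribution functions *)

Section ddf_theory.
Variable R : realType.
Implicit Types (phi psi chi : ddf R) (S : set (ddf R)).
Implicit Types (a b c : {nonneg \bar R}) (r s : R).

(** Testing only nonnegative [s] matches [sup_gt_ge0], where [0 <= r] rules out the empty set, whose
    supremum in [R] is 0. *)
Lemma le_of_ge0_lt (x y : R) :
  0 <= y -> (forall s, 0 <= s -> s < x -> s <= y) -> x <= y.
Proof.
move=> y0 h; rewrite leNgt; apply/negP => yx.
have [ym mx] := midf_lt yx.
have := h _ (le_trans y0 (ltW ym)) mx.
by rewrite leNgt ym.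
Qed.

Lemma sup_gt_ge0 (S : set R) r : 0 <= r -> r < sup S -> exists2 y, S y & r < y.
Proof.
move=> r0; have [->|/set0P S0] := eqVneq S set0; last exact: sup_gt.
by rewrite sup0 ltNge r0.
Qed.

Lemma nonneg_ereal_dense a b : (a%:num < b%:num)%E ->
  exists c, (a%:num < c%:num < b%:num)%E.
Proof.
move=> ab; suff [x /andP[ax xb]] : exists x : \bar R, (a%:num < x < b%:num)%E.
  have [c cx] := nonneg_ereal_ex (le_trans (nonneg_ereal_ge0 a) (ltW ax)).
  by exists c; rewrite cx ax.
have := nonneg_ereal_ge0 a; move: ab.
case: (a%:num)%E => [u| |] //; case: (b%:num)%E => [v| |] // uv _.
  by exists ((u + v) / 2)%:E; rewrite !lte_fin !midf_lt.
by exists (u + 1)%:E; rewrite lte_fin ltrDl ltr01 ltry.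
Qed.

Lemma ddf_le_app phi psi a : phi <= psi -> phi a <= psi a.
Proof. by move=> /ddf_leP. Qed.

Lemma ddf_left_gt phi a r : 0 <= r -> r < phi a ->
  exists2 b, (b%:num < a%:num)%E & r < phi b.
Proof.
by move=> r0; rewrite ddf_sup_lt => /sup_gt_ge0[//|_ [b ba <-]]; exists b.
Qed.

Lemma ddf_le_of_lt phi psi :
  (forall a r, 0 <= r -> r < phi a -> r <= psi a) -> phi <= psi.
Proof.
move=> h; apply/ddf_leP => a; apply: le_of_ge0_lt; first exact: ddf_ge0.
exact: h.
Qed.

Lemma ddf_sup_ub S phi : S phi -> phi <= ddf_sup S.
Proof. by move=> Sphi; have [+ _] := ddf_sup_isLub S; exact. Qed.

Lemma ddf_sup_le S psi : (forall phi, S phi -> phi <= psi) -> ddf_sup S <= psi.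
Proof. by move=> h; have [_] := ddf_sup_isLub S; apply=> phi; exact: h. Qed.

Lemma ddf_sup_gt S a r : 0 <= r -> r < ddf_sup S a ->
  exists2 phi, S phi & r < phi a.
Proof. by move=> r0 /= /sup_gt_ge0[//|_ [phi Sphi <-]]; exists phi. Qed.

Lemma ddf_inf_lb S phi : S phi -> ddf_inf S <= phi.
Proof. by move=> Sphi; have [+ _] := ddf_inf_infimums S; exact. Qed.

Lemma ddf_inf_ge S psi : (forall phi, S phi -> psi <= phi) -> psi <= ddf_inf S.
Proof. by move=> h; have [_] := ddf_inf_infimums S; apply=> phi; exact: h. Qed.

Lemma ddf_le_kappa phi : phi <= kappa.
Proof.
apply/ddf_leP => a; rewrite /=; case: eqP => [a0|_]; last exact: ddf_le1.
rewrite ddf_sup_lt; apply: usup_le => // _ [b ba <-].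
by move: ba; rewrite /= a0 ltNge nonneg_ereal_ge0.
Qed.

Lemma ddf_ge_zero phi : ddf_zero <= phi.
Proof. by apply/ddf_leP => a; exact: ddf_ge0. Qed.

Section step.
Variables (a : {nonneg \bar R}) (r : R).
Hypothesis r01 : 0 <= r <= 1.

(** The inequality is strict because left-continuity forces the value 0 at the jump itself. *)
Let step_fun (b : {nonneg \bar R}) : R := if (a%:num < b%:num)%E then r else 0.

Fact ddf_step_itv b : 0 <= step_fun b <= 1.
Proof. by rewrite /step_fun; case: ifP; rewrite // lexx ler01. Qed.

Fact ddf_step_sup_lt b :
  step_fun b = sup [set step_fun c | c in [set c | (c%:num < b%:num)%E]].
Proof.
have [r0 _] := andP r01; apply/eqP; rewrite eq_le; apply/andP; split.
  rewrite {1}/step_fun; case: ifP => [ab|_]; last first.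
    by apply: usup_ge0 => _ [c _ <-]; exact: ddf_step_itv.
  have [c /andP[ac cb]] := nonneg_ereal_dense ab.
  apply: usup_ub; last by exists c => //; rewrite /step_fun ac.
  by move=> _ [d _ <-]; have /andP[] := ddf_step_itv d.
apply: usup_le => [|_ [c /= cb <-]]; first by have /andP[] := ddf_step_itv b.
rewrite /step_fun; case: ifP => [ac|_]; first by rewrite (lt_trans ac cb).
by case: ifP.
Qed.

Definition ddf_step : ddf R := Ddf ddf_step_itv ddf_step_sup_lt.

Lemma ddf_stepE b : (a%:num < b%:num)%E -> ddf_step b = r.
Proof. by rewrite /= /step_fun => ->. Qed.

Lemma ddf_step_le phi : r <= phi a -> ddf_step <= phi.
Proof.
move=> rphi; apply/ddf_leP => b /=; rewrite /step_fun; case: ifP => [ab|_].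
  exact: le_trans rphi (ddf_lt_le _ ab).
exact: ddf_ge0.
Qed.

End step.

(** Meets are not pointwise, so a common bound at [a] passes to the meet only beyond [a], through
    the step function, which is a lower bound of [S]. *)
Lemma ddf_inf_step S a b r : 0 <= r <= 1 -> (a%:num < b%:num)%E ->
  (forall phi, S phi -> r <= phi a) -> r <= ddf_inf S b.
Proof.
move=> r01 ab h; rewrite -(ddf_stepE r01 ab); apply/ddf_le_app/ddf_inf_ge => phi.
by move=> /h; exact: ddf_step_le.
Qed.

Lemma ddf_mul_ub phi psi a b c : (a%:num + b%:num <= c%:num)%E ->
  phi a * psi b <= (phi ⊙ psi) c.
Proof.
move=> abc; apply: usup_ub; last by exists (a, b).
by move=> _ [p _ <-]; rewrite mulr_ile1 ?ddf_ge0 ?ddf_le1.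
Qed.

(** Lowering the left factor to some [s < phi a] leaves room to move [a] to the left, which pays for
    the later use of [ddf_inf_step]. *)
Lemma ddf_mul_le_ltl phi psi chi :
  (forall a b c s, 0 <= s -> s < phi a -> (a%:num + b%:num <= c%:num)%E ->
    s * psi b <= chi c) -> phi ⊙ psi <= chi.
Proof.
move=> h; apply/ddf_leP => c; apply: usup_le => [|_ [[a b] /= abc <-]].
  exact: ddf_ge0.
have := ddf_ge0 psi b; rewrite le_eqVlt => /predU1P[<-|p0].
  by rewrite mulr0 ddf_ge0.
rewrite -ler_pdivlMr //; apply: le_of_ge0_lt => [|s s0 sphi].
  by rewrite divr_ge0 ?ddf_ge0.
by rewrite ler_pdivlMr //; exact: h abc.
Qed.

Lemma ddf_mulC phi psi : phi ⊙ psi = psi ⊙ phi.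
Proof.
suff H (f g : ddf R) : f ⊙ g <= g ⊙ f by apply/eqP; rewrite eq_le !H.
apply/ddf_leP => c; apply: usup_le => [|_ [[a b] /= abc <-]].
  exact: ddf_ge0.
by rewrite mulrC; apply: ddf_mul_ub; rewrite addeC.
Qed.

Lemma ddf_mul_le2 phi psi chi : psi <= chi -> phi ⊙ psi <= phi ⊙ chi.
Proof.
move=> h; apply: ddf_mul_le_ltl => a b c s s0 sphi abc.
apply: (le_trans _ (ddf_mul_ub phi chi abc)).
by apply: ler_pM; rewrite ?ddf_ge0 ?ddf_le_app // ltW.
Qed.

(** Left-continuity frees a positive length [e = a - b], at which [kappa] is already 1. *)
Lemma ddf_le_mul_kappa phi : phi <= phi ⊙ kappa.
Proof.
apply: ddf_le_of_lt => a r r0 /(ddf_left_gt r0)[b ba rb].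
have e0 : (0 < a%:num - b%:num)%E by rewrite sube_gt0.
have [e eE] := nonneg_ereal_ex (ltW e0).
have bfin : (b%:num \is a fin_num)%E.
  by rewrite ge0_fin_numE ?nonneg_ereal_ge0// (lt_le_trans ba) ?leey.
have /(ddf_mul_ub phi kappa) : (b%:num + e%:num <= a%:num)%E.
  by rewrite eE addeC subeK.
have -> : kappa e = 1 :> R by rewrite /= eE gt_eqF.
by rewrite mulr1; apply/le_trans/ltW.
Qed.

End ddf_theory.

(** * Ultrafilters: extension, avoidance of an ideal, prescribed sums *)

Section ultrafilter_theory.
Variable X : Type.
Implicit Types (A B : set X) (xx yy : ultrafilter X).

#[local] Instance uf_proper T (xx : ultrafilter T) :
  ProperFilter (xx : set_system T).
Proof. exact: (@ultra_proper _ _ (uf_ultra xx)). Qed.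

Lemma uf_setC xx A : ~ (xx : set_system X) A -> (xx : set_system X) (~` A).
Proof. by move=> nA; have [] := in_ultra_setVsetC A (uf_ultra xx). Qed.

Lemma uf_setU xx A B : (xx : set_system X) (A `|` B) ->
  (xx : set_system X) A \/ (xx : set_system X) B.
Proof.
move=> AB; have [?|nA] := pselect ((xx : set_system X) A); first by left.
right; apply: filterS (filterI AB (uf_setC nA)).
by move=> x [[]].
Qed.

Lemma uf_sub_eq xx yy : (xx : set_system X) `<=` yy -> xx = yy.
Proof.
move=> sxy; apply/esym/ultrafilter_ext.
exact: (@max_filter _ _ (uf_ultra xx) _ _ sxy).
Qed.

Lemma uf_extension T (F : set_system T) : ProperFilter F ->
  exists xx : ultrafilter T, F `<=` (xx : set_system T).
Proof.
by move=> /ultraFilterLemma[G [GU FG]]; exists (Ultrafilter GU).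
Qed.

(** The sets [A \ B] with [B] in [I] are nonempty and form the base of a proper filter; any
    ultrafilter extending it will do. *)
Lemma uf_avoid_ideal (I : set (set X)) A :
  I set0 -> (forall B C, I B -> I C -> I (B `|` C)) ->
  (forall B C, B `<=` C -> I C -> I B) -> ~ I A ->
  exists2 xx : ultrafilter X, (xx : set_system X) A &
    forall B, (xx : set_system X) B -> ~ I B.
Proof.
move=> I0 IU Isub nIA.
have PF : ProperFilter (filter_from I (fun B => A `\` B)).
  apply: filter_from_proper => [|B IB].
    apply: filter_from_filter; first by exists set0.
    move=> B C IB IC; exists (B `|` C); first exact: IU.
    by move=> x [Ax nBC]; split; split=> // h; apply: nBC; [left|right].
  apply: contrapT => /nonemptyPn AB0; apply/nIA/Isub/IB => x Ax.
  by apply: contrapT => nBx; have : set0 x by rewrite -AB0.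
have [xx Fxx] := uf_extension PF; exists xx.
  by apply: Fxx; exists set0 => // x [].
move=> B xB IB; have xAB : (xx : set_system X) (A `\` B) by apply: Fxx; exists B.
by have [x [Bx [_ nBx]]] := filter_ex (filterI xB xAB).
Qed.

(** The sets of members of [P] containing a given [A] in [xx] form a proper filter base. The sum of
    an ultrafilter extending it includes [xx], hence equals it by maximality. *)
Lemma uf_sum_ex xx (P : set (ultrafilter X)) :
  (forall A, (xx : set_system X) A ->
    exists2 yy : ultrafilter X, (yy : set_system X) A & P yy) ->
  exists2 XX : ultrafilter (ultrafilter X),
    (XX : set_system (ultrafilter X)) P & sum_uf XX = xx.
Proof.
move=> h.
have PF : ProperFilter (filter_from (xx : set_system X)
    (fun A => P `&` [set yy : ultrafilter X | (yy : set_system X) A])).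
  apply: filter_from_proper => [|A /h[yy yA Pyy]]; last by exists yy.
  apply: filter_from_filter; first by exists setT; exact: filterT.
  move=> A B xA xB; exists (A `&` B); first exact: filterI.
  by move=> yy [Pyy yAB]; split; split=> //=; apply: filterS yAB => x [].
have [XX FXX] := uf_extension PF; exists XX.
  by apply: FXX; exists setT; [exact: filterT|move=> yy []].
by apply/esym/uf_sub_eq => A xA; apply: FXX; exists A => // yy [].
Qed.

End ultrafilter_theory.

#[local] Existing Instance uf_proper.

(** * From approach structures to ultrafilter convergence *)

Section approach_to_limit.
Variables (R : realType) (X : Type) (delta : X -> set X -> ddf R).
Hypothesis delta_pa : is_prob_approach delta.

Lemma prob_approach_mono x A B : A `<=` B -> delta x A <= delta x B.
Proof.
move=> AB; have -> : B = A `|` B by apply/esym/setUidPr.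
by rewrite (pa_setU delta_pa); apply: ddf_sup_ub; left.
Qed.

Lemma approach_of_limit_of : approach_of (limit_of delta) = delta.
Proof.
apply/funext => x; apply/funext => A; apply/eqP; rewrite eq_le; apply/andP.
split.
  by apply: ddf_sup_le => _ [xx xA <-]; apply: ddf_inf_lb; exists A.
apply: ddf_le_of_lt => a r r0 /(ddf_left_gt r0)[b ba rb].
(* The ideal is taken at [b < a]: all members of [xx] then have distance value above [r] at [b], so
   their meet is at least [r] at [a]. *)
have [|B C IB IC|B C BC|/=|xx xA xxP] :=
    @uf_avoid_ideal X [set B | delta x B b <= r] A.
- by rewrite /= (pa_set0 delta_pa).
- rewrite /= (pa_setU delta_pa); apply: usup_le => //.
  by move=> _ [phi [] -> <-].
- by apply: le_trans; have /ddf_leP := prob_approach_mono x BC; exact.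
- by apply/negP; rewrite -ltNge.
apply: (@le_trans _ _ (limit_of delta xx x a)); last first.
  by apply/ddf_le_app/ddf_sup_ub; exists xx.
apply: (ddf_inf_step _ ba) => [|_ [B xB <-]].
  by rewrite r0 (le_trans (ltW rb)) ?ddf_le1.
by have /negP := xxP _ xB; rewrite -ltNge => /ltW.
Qed.

Lemma limit_of_prob_limit : is_prob_limit (limit_of delta).
Proof.
split=> [x|XX yy z].
  apply: ddf_inf_ge => _ [A xA <-]; rewrite -(pa_point delta_pa x).
  by apply: prob_approach_mono => y ->; exact: xA.
apply: ddf_inf_ge => _ [A XA <-]; set Phi := ddf_inf _.
apply: ddf_mul_le_ltl => a b c s s0 /(ddf_left_gt s0)[a' a'a sa'] abc.
have s01 : 0 <= s <= 1 by rewrite s0 (le_trans (ltW sa')) ?ddf_le1.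
(* [E] is an enlargement of [A], so [pa_enlarge] applies to it once it is known to belong to [yy].
   The step jumps at [a'] in order to have value [s] at [a]. *)
set E := [set y | ddf_step a' s01 <= delta y A].
have yE : (yy : set_system X) E.
  apply: contrapT => /uf_setC yCE.
  (* If [E] were not in [yy], this term of the meet would yield a point outside [E] to which some
     [xx] containing [A] converges with value above [s] at [a'], putting that point in [E]. *)
  have /ddf_leP/(_ a')/(lt_le_trans sa') : Phi <= ddf_sup
      [set limit_of delta xx y | xx in [set xx : ultrafilter X |
         (xx : set_system X) A] & y in ~` E].
    by apply: ddf_inf_lb; exists [set xx : ultrafilter X |
         (xx : set_system X) A] => //; exists (~` E).
  move=> /(ddf_sup_gt s0)[_ [xx xA [y nEy <-]] slxx]; apply: nEy.
  apply: ddf_step_le; apply: (le_trans (ltW slxx)).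
  by apply/ddf_le_app/ddf_inf_lb; exists A.
rewrite mulrC; apply: (@le_trans _ _ ((delta z E ⊙ ddf_step a' s01) c)).
  rewrite addeC in abc; apply: le_trans (ddf_mul_ub _ _ abc).
  rewrite (ddf_stepE s01 a'a); apply: ler_wpM2r => //.
  by apply/ddf_le_app/ddf_inf_lb; exists E.
exact/ddf_le_app/(pa_enlarge delta_pa).
Qed.

End approach_to_limit.

(** * From ultrafilter convergence to approach structures *)

Section limit_to_approach.
Variables (R : realType) (X : Type) (l : ultrafilter X -> X -> ddf R).
Hypothesis l_pl : is_prob_limit l.

Lemma le_approach_of (xx : ultrafilter X) x A :
  (xx : set_system X) A -> l xx x <= approach_of l x A.
Proof. by move=> xA; apply: ddf_sup_ub; exists xx. Qed.

Lemma approach_of_mono x A B : A `<=` B ->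
  approach_of l x A <= approach_of l x B.
Proof.
move=> AB; apply: ddf_sup_le => _ [xx xA <-]; apply: le_approach_of.
exact: filterS xA.
Qed.

Lemma approach_of_enlarge x A (phi : ddf R) :
  approach_of l x [set y | phi <= approach_of l y A] ⊙ phi
    <= approach_of l x A.
Proof.
(* The factors are swapped so that the slack falls on [phi], the factor to be compared with a
   meet. *)
set E := [set y | _]; rewrite ddf_mulC.
apply: ddf_mul_le_ltl => b a c s s0 /(ddf_left_gt s0)[b' b'b sb'] bac.
have s01 : 0 <= s <= 1 by rewrite s0 (le_trans (ltW sb')) ?ddf_le1.
have := s0; rewrite le_eqVlt => /predU1P[<-|sp]; first by rewrite mul0r ddf_ge0.
rewrite mulrC -ler_pdivlMr //; apply: usup_le => [|_ [_ [yy yE <-] <-]].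
  by rewrite divr_ge0 // ddf_ge0.
rewrite ler_pdivlMr // mulrC.
(* For [y] in [E], [g y] contains [A] and converges to [y] with value above [s]; elsewhere
   [principal_uf y] is a mere default. *)
have /choice[g gP] : forall y, exists xx : ultrafilter X, E y ->
    (xx : set_system X) A /\ s < l xx y b'.
  move=> y.
  have [Ey|nEy] := pselect (E y); last by exists (principal_uf y).
  have /ddf_leP/(_ b')/(lt_le_trans sb')/(ddf_sup_gt s0) := Ey.
  by move=> [_ [xx xA <-] sxx]; exists xx.
pose XX := image_uf g yy.
have sumA : (sum_uf XX : set_system X) A.
  by rewrite /=; apply: filterS yE => y /gP[].
apply: le_trans (_ : l (sum_uf XX) x c <= _); last first.
  exact/ddf_le_app/le_approach_of.
have /ddf_leP/(_ c) := pl_trans l_pl XX yy x; apply: le_trans.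
apply: le_trans (ddf_mul_ub _ _ bac); apply: ler_wpM2r; first exact: ddf_ge0.
apply: (ddf_inf_step s01 b'b) => _ [AA /= gAA [B yB <-]].
(* The preimage of [AA] under [g], [B] and [E] all lie in [yy]; at a common point [y], the pair
   [g y], [y] witnesses the join. *)
have [y [[gyAA By] /gP[_ sy]]] := filter_ex (filterI (filterI gAA yB) yE).
apply: (le_trans (ltW sy)); apply/ddf_le_app/ddf_sup_ub.
by exists (g y) => //; exists y.
Qed.

Lemma approach_of_prob_approach : is_prob_approach (approach_of l).
Proof.
split=> [x|x|x A B|]; last exact: approach_of_enlarge.
- apply/eqP; rewrite eq_le ddf_le_kappa /=.
  by apply: le_trans (pl_refl l_pl x) (le_approach_of _ _).
- apply/eqP; rewrite eq_le ddf_ge_zero andbT.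
  by apply: ddf_sup_le => phi [xx /filter_ex[]].
- apply/eqP; rewrite eq_le; apply/andP; split; apply: ddf_sup_le.
    move=> _ [xx /uf_setU[] xA <-].
      by apply: le_trans (le_approach_of x xA) (ddf_sup_ub _); left.
    by apply: le_trans (le_approach_of x xA) (ddf_sup_ub _); right.
  by move=> _ [->|->]; apply: approach_of_mono; [left|right].
Qed.

(** For the hard inequality, each [A] in [xx] belongs to an ultrafilter converging to [x] with value
    above [r] at [b]. These are gathered into [XX] with sum [xx], and transitivity is applied along
    [principal_uf x], where reflexivity supplies [kappa]. *)
Lemma limit_of_approach_of : limit_of (approach_of l) = l.
Proof.
apply/funext => xx; apply/funext => x; apply/eqP; rewrite eq_le; apply/andP.
split; last by apply: ddf_inf_ge => _ [A xA <-]; exact: le_approach_of.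
apply: ddf_le_of_lt => a r r0 /(ddf_left_gt r0)[b ba rb].
have r01 : 0 <= r <= 1 by rewrite r0 (le_trans (ltW rb)) ?ddf_le1.
have [A xA|XX XXP sumXX] := @uf_sum_ex X xx [set yy | r < l yy x b].
  have /ddf_leP/(_ b)/(lt_le_trans rb)/(ddf_sup_gt r0) :
      limit_of (approach_of l) xx x <= approach_of l x A.
    by apply: ddf_inf_lb; exists A.
  by move=> [_ [yy yA <-] ryy]; exists yy.
have := pl_trans l_pl XX (principal_uf x) x; rewrite sumXX.
set Phi := ddf_inf _ => PhiP.
apply: (@le_trans _ _ (Phi a)).
  apply: (ddf_inf_step r01 ba) => _ [AA XAA [B xB <-]].
  have [yy [AAyy ryy]] := filter_ex (filterI XAA XXP).
  apply: (le_trans (ltW ryy)); apply/ddf_le_app/ddf_sup_ub.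
  by exists yy => //; exists x => //; exact: xB.
apply/ddf_le_app/(le_trans _ PhiP)/(le_trans (ddf_le_mul_kappa _)).
exact: ddf_mul_le2 (pl_refl l_pl x).
Qed.

End limit_to_approach.

(** Forward, [l'] is recovered as a meet over sets [B] of the image ultrafilter, and contractivity
    is applied to the preimage of [B]. Backward, the image ultrafilter contains the direct image of
    each member of [xx]. *)
Lemma contractive_limitP (R : realType) (X Y : Type)
    (l : ultrafilter X -> X -> ddf R) (l' : ultrafilter Y -> Y -> ddf R)
    (f : X -> Y) : is_prob_limit l' ->
  contractive (approach_of l) (approach_of l') f <->
  forall (xx : ultrafilter X) (x : X), l xx x <= l' (image_uf f xx) (f x).
Proof.
move=> l'_pl; split=> [fc xx x|fl x A].
  rewrite -[in leRHS](limit_of_approach_of l'_pl).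
  apply: ddf_inf_ge => _ [B fB <-].
  apply: (le_trans (le_approach_of l x fB)); apply: (le_trans (fc _ _)).
  by apply: approach_of_mono => _ [y By <-].
apply: ddf_sup_le => _ [xx xA <-]; apply: (le_trans (fl _ _)).
by apply: le_approach_of => /=; apply: filterS xA => y Ay; exists y.
Qed.

Theorem corollary3p7 (R : realType) :
  (forall (X : Type) (delta : X -> set X -> ddf R),
     is_prob_approach delta ->
     is_prob_limit (limit_of delta) /\
     approach_of (limit_of delta) = delta) /\
  (forall (X : Type) (l : ultrafilter X -> X -> ddf R),
     is_prob_limit l ->
     is_prob_approach (approach_of l) /\
     limit_of (approach_of l) = l) /\
  (forall (X Y : Type) (l : ultrafilter X -> X -> ddf R)
      (l' : ultrafilter Y -> Y -> ddf R) (f : X -> Y),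
     is_prob_limit l -> is_prob_limit l' ->
     (contractive (approach_of l) (approach_of l') f <->
      forall (xx : ultrafilter X) (x : X),
        l xx x <= l' (image_uf f xx) (f x))).
Proof.
split=> [X delta delta_pa|]; last split=> [X l l_pl|X Y l l' f _ l'_pl].
- by split; [exact: limit_of_prob_limit|exact: approach_of_limit_of].
- by split; [exact: approach_of_prob_approach|exact: limit_of_approach_of].
- exact: contractive_limitP.
Qed.
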